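(* Let $\Gamma$ be a metrized graph with vertex set $V(\Gamma)$ and edge set $E(\Gamma)$, and let $r$ be its resistance function. Let $e_i \in E(\Gamma)$ be an edge of length $L_i$ with end points $p_i$ and $q_i$. If both $x$ and $y$ belong to the same edge $e_i$, then $$r(x,y)= |x-y|-(x-y)^2\, \frac{L_i - r(p_i,q_i)}{L_i^2},$$ where on the right-hand side $x,y\in[0,L_i]$ denote the parameters of the points $x,y\in e_i$.
   Context: A metrized graph $\Gamma$ is a finite connected graph whose edges are equipped with a distinguished parametrization by line segments (multiple edges and self-loops are allowed). The valence of $p\in\Gamma$ is the number of directions emanating from $p$. A vertex set $V(\Gamma)$ is a finite non-empty subset of $\Gamma$ containing every point of valence $\neq 2$ (additional points of valence 2 may be included). The set $E(\Gamma)$ of edges is the set of closed line segments with end points in $V(\Gamma)$ into which $V(\Gamma)$ divides $\Gamma$; the length of $e_i$ is a positive real number $L_i$. Parametrization convention: an edge $e_i$ of length $L_i$ with end points $p_i,q_i$ is identified with $[0,L_i]$ so that $p_i$ corresponds to $0$ and $q_i$ to $L_i$. A point of $e_i$ and the corresponding real number in $[0,L_i]$ are denoted by the same letter: in the arguments of $r$ the letters denote points of $\Gamma$, elsewhere in formulas they denote the real parameters. Voltage and resistance functions: view $\Gamma$ as a resistive electric circuit in which each edge has resistance equal to its length. For $x,y,z\in\Gamma$, $j_z(x,y)$ is the voltage difference between $x$ and $z$ when unit current enters at $y$ and exits at $z$ (with reference voltage $0$ at $z$). Equivalently, for fixed $y,z$, $x\mapsto j_z(x,y)$ is the unique continuous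 piecewise affine function $f$ on $\Gamma$ with $f(z)=0$ and $\Delta f=\delta_y-\delta_z$, where $\Delta f=-\sum_{p}\sigma_p(f)\,\delta_p$ and $\sigma_p(f)$ is the sum of the slopes of $f$ in all directions emanating from $p$. The resistance function is $r(x,y)=j_y(x,x)$, the effective resistance between $x$ and $y$. *)

(* Defs.v *)
From HB Require Import structures.
From mathcomp Require Import all_boot all_order all_algebra.
From mathcomp Require Import all_classical all_reals all_analysis.

Set Implicit Arguments.
Unset Strict Implicit.
Unset Printing Implicit Defensive.

Import Order.TTheory GRing.Theory Num.Theory.
Import numFieldNormedType.Exports.

Local Open Scope classical_set_scope.
Local Open Scope ring_scope.

(* A metrized graph together with a vertex set.  Multiple edges and self-loops
   are allowed.  The edge e is the segment [0, len e], its parameter 0 being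
   glued to src e and its parameter len e to tgt e. *)
Record metrized_graph (R : realType) := MetrizedGraph {
  vertex : finType;
  edge : finType;
  src : edge -> vertex;
  tgt : edge -> vertex;
  len : edge -> R;
  vertex_neq0 : (0 < #|vertex|)%N;
  len_gt0 : forall e, 0 < len e;
  graph_connected : forall u v : vertex,
    connect (fun a b => [exists e, ((src e == a) && (tgt e == b)) ||
                                   ((src e == b) && (tgt e == a))]) u v
}.

Section MetrizedGraph.
Context {R : realType}.
Variable G : metrized_graph R.

(* The underlying set of the glued space: the vertices and the interior points
   of the edges. *)
Definition pt : Type :=
  (vertex G + {x : edge G * R | 0 < x.2 < len x.1})%type.

Definition vpt (v : vertex G) : pt := inl v.

(* The parametrization of the edge e by [0, len e].  Parameters outside of
   that interval are clamped to the nearest end point. *)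
Definition ept (e : edge G) (t : R) : pt :=
  if insub (e, t) is Some u then inr u
  else inl (if t <= 0 then src e else tgt e).

(* Finitely many breakpoints S, and g affine on each open subinterval that
   avoids S. *)
Definition piecewise_affine_on (a b : R) (g : R -> R) : Prop :=
  exists S : seq R, forall c d : R, a <= c -> c < d -> d <= b ->
    (forall s, s \in S -> ~~ (c < s < d)) ->
    exists m k : R, forall t, c < t < d -> g t = m * t + k.

(* The graph carries the quotient topology of the disjoint union of the
   segments, so continuity is continuity along every closed edge. *)
Definition cpa (f : pt -> R) : Prop :=
  forall e : edge G,
    {within `[0, len e], continuous (fun t => f (ept e t))} /\
    piecewise_affine_on 0 (len e) (fun t => f (ept e t)).

(* Slope of f at the point of parameter t of e, in the direction of increasing
   (fwd) or decreasing (bwd) parameters. *)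
Definition slope_fwd (f : pt -> R) (e : edge G) (t : R) : R :=
  lim ((f (ept e (t + h)) - f (ept e t)) / h @[h --> 0^'+]).

Definition slope_bwd (f : pt -> R) (e : edge G) (t : R) : R :=
  lim ((f (ept e (t - h)) - f (ept e t)) / h @[h --> 0^'+]).

(* The directions emanating from a vertex are the edge ends glued to it (a
   self-loop has two of them); an interior point of an edge has two. *)
Definition sigma (f : pt -> R) (p : pt) : R :=
  match p with
  | inl v => \sum_(e | src e == v) slope_fwd f e 0 +
             \sum_(e | tgt e == v) slope_bwd f e (len e)
  | inr u => slope_fwd f (val u).1 (val u).2 + slope_bwd f (val u).1 (val u).2
  end.

(* The discrete measure Delta f = - \sum_p sigma_p(f) delta_p, given by the
   mass it puts on each point; likewise for delta_y. *)
Definition laplacian (f : pt -> R) (p : pt) : R := - sigma f p.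

Definition delta (y p : pt) : R := (p == y)%:R.

Definition is_voltage (z y : pt) (f : pt -> R) : Prop :=
  [/\ cpa f, f z = 0 & forall p, laplacian f p = delta y p - delta z p].

(* voltage z x y is j_z(x, y). *)
Definition voltage (z x y : pt) : R :=
  (get [set f : pt -> R | is_voltage z y f]) x.

Definition resistance (x y : pt) : R := voltage y x x.

End MetrizedGraph.

(* Main.v *)
Require Import Defs.
From HB Require Import structures.
From mathcomp Require Import all_boot all_order all_algebra.
From mathcomp Require Import all_classical all_reals all_analysis.
From mathcomp Require Import ring lra.

Set Implicit Arguments.
Unset Strict Implicit.
Unset Printing Implicit Defensive.

Import Order.TTheory GRing.Theory Num.Theory.
Import numFieldNormedType.Exports.

Local Open Scope classical_set_scope.
Local Open Scope ring_scope.

(* On the edge e, of length L, the Green function of the segment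
   k_c(t) = min(t, c) - t c / L, extended by 0 to the rest of the graph, satisfies
   Delta k_c = delta_c - (1 - c/L) delta_p - (c/L) delta_q.  If Delta g = delta_p - delta_q,
   then f = k_x - k_y + ((y - x)/L) g therefore has Delta f = delta_x - delta_y, and
   r(x, y) = f(x) - f(y) by uniqueness of the voltage up to constants, while
   r(p, q) = g(p) - g(q), where g is affine on e.
   A harmonic function is affine on each edge, so uniqueness of the voltage and
   existence of g reduce to the invertibility, up to constants, of the weighted
   Laplacian of the finite graph. *)

(** * Affine functions on a real interval: one-sided germs and passage from local to global *)

Section RealLine.
Context {R : realType}.
Implicit Types (g : R -> R) (a b s t m k : R).

Lemma gap_around (S : seq R) t :
  exists2 d : R, 0 < d & forall s, s \in S -> s != t -> d <= `|s - t|.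
Proof.
elim: S => [|u S [d d0 IH]]; first by exists 1.
have [->|ut] := eqVneq u t.
  exists d => // s; rewrite inE => /orP[/eqP-> /eqP//|]; exact: IH.
exists (Num.min d `|u - t|).
  by rewrite lt_min d0 normr_gt0 subr_eq0.
move=> s; rewrite inE ge_min => /orP[/eqP->|sS st]; first by rewrite lexx orbT.
by rewrite IH.
Qed.

(** The sign [s] treats the right and left germs at once; [t] may itself be a breakpoint, since only
    a one-sided interval avoiding the other breakpoints is used. *)
Lemma piecewise_affine_germ a b g t s d :
  {within `[a, b], continuous g} -> piecewise_affine_on a b g ->
  s = 1 \/ s = -1 -> 0 < d -> a <= t <= b -> a <= t + s * d <= b ->
  exists m, \forall h \near 0^'+, g (t + s * h) = g t + m * h.
Proof.
move=> /subspace_continuousP cg [S gS] s1 d0 tab tdab.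
have [e e0 eS] := gap_around S t.
pose r := Num.min d e.
have r0 : 0 < r by rewrite lt_min d0.
have [rd re] : r <= d /\ r <= e by rewrite !ge_min !lexx orbT.
have noS u : u \in S -> u != t -> r <= u - t \/ r <= t - u.
  by move=> uS /(eS _ uS); case: ger0P => _ ?; [left|right]; lra.
have [m [k gE]] : exists m k, forall h, 0 < h < r -> g (t + s * h) = m * h + k.
  case: s1 => ->{s} in tdab *.
    have [||||m [k mk]] := gS t (t + r); try lra.
      move=> u uS; apply/negP => tu.
      have ut : u != t by apply/eqP => ut; lra.
      by case: (noS u uS ut); lra.
    exists m, (m * t + k) => h hr; rewrite mk; lra.
  have [||||m [k mk]] := gS (t - r) t; try lra.
    move=> u uS; apply/negP => tu.
    have ut : u != t by apply/eqP => ut; lra.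
    by case: (noS u uS ut); lra.
  exists (- m), (m * t + k) => h hr; rewrite mk; lra.
have nr : \forall h \near (0:R)^'+, 0 < h < r.
  by near=> h; apply/andP; split.
(* The affine formula is known only on the open interval beside [t]; continuity at [t] identifies
   its constant term. *)
suff -> : g t = k.
  by exists m; apply: filterS nr => h /gE ->; rewrite addrC.
have cv1 : g (t + s * h) @[h --> 0^'+] --> g t.
  apply: cvg_comp (cg t _); last by rewrite /= in_itv.
  move=> A; rewrite /= /nbhs /= => /nbhs_ballP[q /= q0 qA].
  near=> h; apply: qA => /=; last first.
    rewrite in_itv/=.
    have : 0 < h < r by near: h.
    case: s1 => -> in tdab *; nra.
  have : 0 < h by near: h; exact: nbhs_right_gt.
  have : h < q by near: h; exact: nbhs_right_lt.
  move=> ? ?; rewrite /ball/= ltr_norml; case: s1 => ->; lra.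
have cv2 : g (t + s * h) @[h --> 0^'+] --> k.
  have : (m * h + k) @[h --> (0:R)^'+] --> m * 0 + k.
    apply: cvg_at_right_filter; apply: cvgD; last exact: cvg_cst.
    by apply: cvgMr; exact: cvg_id.
  rewrite mulr0 add0r; apply: cvg_trans; apply: near_eq_cvg.
  by apply: filterS nr => h /gE ->.
exact: (cvg_unique _ cv1 cv2).
Unshelve. all: by end_near.
Qed.

Lemma is_derive_affine m k t : is_derive t 1 (fun u : R => k + m * u) m.
Proof.
by apply: is_derive_eq; rewrite add0r mul1r; exact: mulr1.
Qed.

Lemma locally_affine_affine a b g :
  a < b -> {within `[a, b], continuous g} ->
  (forall t, a < t < b ->
    exists m, \forall u \near t, g u = g t + m * (u - t)) ->
  forall t, a <= t <= b -> g t = g a + (g b - g a) / (b - a) * (t - a).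
Proof.
move=> ab cg gaff.
(* g is differentiable with a locally constant derivative; apply MVT to both. *)
have gder t : a < t < b -> exists m, \forall u \near t, is_derive u (1 : R) g m.
  move=> /gaff[m /nbhs_interior mg]; exists m.
  apply: filterS mg => u ug.
  have := is_derive_affine m (g t - m * t) u; apply: near_eq_is_derive.
  by apply: filterS ug => v ->; ring.
have dder t : a < t < b -> is_derive t 1 (derive1 g) 0.
  move=> /gder[m mg].
  have : is_derive t 1 (cst m : R -> R) 0 by exact: is_derive_cst.
  apply: near_eq_is_derive.
  by apply: filterS mg => u ug; rewrite derive1E derive_val.
have dg t : a < t < b -> is_derive t 1 g (derive1 g t).
  move=> /gder[m /nbhs_singleton mt].
  by rewrite derive1E derive_val.
have dcst t u : a < t -> t < u -> u < b -> derive1 g u = derive1 g t.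
  move=> at_ tu ub.
  have [||c _] := @MVT R (derive1 g) (cst 0) t u tu.
  - move=> x /[!in_itv]/= /andP[? ?]; apply: dder; lra.
  - apply: derivable_within_continuous => x /[!in_itv]/= /andP[? ?].
    by have [] : is_derive x 1 (derive1 g) 0 by apply: dder; lra.
  - by rewrite /= mul0r => /eqP; rewrite subr_eq0 => /eqP.
(* The midpoint is the reference because the derivative is controlled only at interior points. *)
pose m := derive1 g ((a + b) / 2).
have dm t : a < t < b -> derive1 g t = m.
  move=> tab; have [||->//] := ltgtP t ((a + b) / 2) => tm.
  - by apply/esym/dcst => //; lra.
  - by apply: dcst => //; lra.
have gm t : a <= t <= b -> g t = g a + m * (t - a).
  move=> /andP[]; rewrite le_eqVlt => /predU1P[<- _|at_ tb].
    by rewrite subrr mulr0 addr0.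
  have [||c ct] := @MVT R g (cst m) a t at_.
  - move=> x /[!in_itv]/= /andP[? ?].
    rewrite /= -(dm x); [apply: dg|]; lra.
  - apply: continuous_subspaceW cg => x /=; rewrite !in_itv/= => /andP[-> ?]/=; lra.
  - move=> /= <-; ring.
move=> t tab; rewrite (gm t tab) (gm b); last lra.
have : b - a != 0 by rewrite subr_eq0 gt_eqF.
by move=> ?; field.
Unshelve. all: by end_near.
Qed.

End RealLine.

(** * The weighted Laplacian of the finite graph: kernel and range *)

Section DiscreteLaplacian.
Context {R : realType}.
Variable G : metrized_graph R.
Implicit Types (f g : pt G -> R) (u w b : vertex G -> R) (e : edge G) (v : vertex G).

Definition discrete_laplacian u v : R :=
  \sum_(e | src e == v) (u (tgt e) - u v) / len e +
  \sum_(e | tgt e == v) (u (src e) - u v) / len e.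

(** Summation by parts: each edge is counted once at its source and once at its target, with
    opposite increments of [u]. *)
Lemma discrete_green u w :
  \sum_v w v * discrete_laplacian u v =
  - \sum_e (w (tgt e) - w (src e)) * (u (tgt e) - u (src e)) / len e.
Proof.
have fiber (h : edge G -> vertex G) (F : edge G -> vertex G -> R) :
    \sum_v \sum_(e | h e == v) F e v = \sum_e F e (h e).
  rewrite (exchange_big_dep xpredT) //=; apply: eq_bigr => e _.
  by rewrite (big_pred1 (h e)) // => v; rewrite eq_sym.
under eq_bigr do rewrite mulrDr !big_distrr /=.
rewrite big_split /= !fiber -big_split /= -sumrN; apply: eq_bigr => e _.
ring.
Qed.

(** By [discrete_green] with [w = u], the Dirichlet energy vanishes. Its terms are nonnegative, so
    [u] agrees at the two ends of every edge, and connectedness concludes. *)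
Lemma discrete_harmonic_constant u :
  (forall v, discrete_laplacian u v = 0) -> forall v v', u v = u v'.
Proof.
move=> u0.
have edge_eq e : u (src e) = u (tgt e).
  have /eqP := discrete_green u u.
  rewrite big1 => [|v _]; last by rewrite u0 mulr0.
  rewrite eq_sym oppr_eq0 psumr_eq0 => [|e' _]; last first.
    by rewrite -expr2 divr_ge0 ?sqr_ge0 ?ltW ?len_gt0.
  move=> /allP/(_ e (mem_index_enum _))/=.
  rewrite -expr2 mulf_eq0 invr_eq0 (gt_eqF (len_gt0 e)) orbF sqrf_eq0.
  by rewrite subr_eq0 => /eqP.
move=> v v'; have /connectP[p vp ->] := graph_connected v v'.
elim: p v vp => //= a p IH v /andP[/existsP[e es] /IH <-].
by case/orP: es => /andP[/eqP<- /eqP<-].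
Qed.

(* The discrete Laplacian kills the constants; adding the all-ones matrix makes it
   invertible without changing it on functions of zero sum. *)
Definition shifted_laplacian (u : {ffun vertex G -> R^o}) : {ffun vertex G -> R^o} :=
  [ffun v => discrete_laplacian u v + \sum_v' u v'].

Fact shifted_laplacian_linear : linear shifted_laplacian.
Proof.
move=> a u w; apply/ffunP => v; rewrite !ffunE /discrete_laplacian.
rewrite scalerDr !scaler_sumr /GRing.scale/= mulrDr !mulr_sumr.
rewrite addrACA -big_split/= [X in _ = X + _]addrACA -!big_split/=.
by congr (_ + _ + _); apply: eq_bigr => e _; rewrite !ffunE /GRing.scale/=; ring.
Qed.

HB.instance Definition _ := GRing.isLinear.Build R
  {ffun vertex G -> R^o} {ffun vertex G -> R^o} _ shifted_laplacian
  shifted_laplacian_linear.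

Lemma sum_discrete_laplacian u : \sum_v discrete_laplacian u v = 0.
Proof.
have := discrete_green u (fun=> 1); under eq_bigr do rewrite mul1r.
by move=> ->; rewrite big1 ?oppr0 // => e _; rewrite subrr !mul0r.
Qed.

(** An injective endomorphism of a finite-dimensional space is onto, so [b] has a preimage under the
    shifted Laplacian; this preimage has zero sum, which makes the shift disappear. *)
Lemma discrete_poisson b :
  \sum_v b v = 0 -> exists u, forall v, discrete_laplacian u v = b v.
Proof.
move=> b0.
(* The Laplacian part sums to zero, so the left-hand sum is the number of vertices times the sum of
   [U]. *)
have sum0 (U : {ffun vertex G -> R^o}) :
    \sum_v shifted_laplacian U v = 0 -> \sum_v U v = 0.
  under eq_bigr do rewrite ffunE.
  rewrite big_split/= sum_discrete_laplacian add0r sumr_const => /eqP.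
  by rewrite mulrn_eq0 eqn0Ngt vertex_neq0 => /eqP.
have inj : lker (linfun shifted_laplacian) == 0%VS.
  rewrite -subv0; apply/subvP => U; rewrite memv_ker lfunE/= memv0 => /eqP U0.
  have sU : \sum_v U v = 0.
    by apply: sum0; rewrite U0 big1 // => v _; rewrite ffunE.
  have Ucst v v' : U v = U v'.
    apply: discrete_harmonic_constant => {}v.
    by have /ffunP/(_ v) := U0; rewrite !ffunE sU addr0.
  apply/eqP/ffunP => v; rewrite ffunE.
  have : \sum_(v' : vertex G) U v' = U v *+ #|vertex G|.
    by rewrite -sumr_const; apply: eq_bigr => v' _.
  by rewrite sU => /esym/eqP; rewrite mulrn_eq0 eqn0Ngt vertex_neq0 => /eqP.
have /memv_imgP[U _] : [ffun v => b v : R^o] \in limg (linfun shifted_laplacian).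
  by rewrite lker0_limgf ?memvf.
rewrite lfunE/= => bU.
have sU : \sum_v U v = 0.
  by apply: sum0; rewrite -bU -[RHS]b0; apply: eq_bigr => v _; rewrite ffunE.
exists U => v; have /ffunP/(_ v) := bU.
by rewrite !ffunE sU addr0.
Qed.

End DiscreteLaplacian.

(** * Continuous piecewise affine functions on the graph, their slopes and Laplacian *)

Section PiecewiseAffine.
Context {R : realType}.
Variable G : metrized_graph R.
Implicit Types (f g : pt G -> R) (u : vertex G -> R) (e : edge G) (v : vertex G).

Lemma ept_src e : ept e 0 = vpt (src e).
Proof. by rewrite /ept; case: insubP => [? /=|_]; [rewrite ltxx|rewrite lexx]. Qed.

Lemma ept_tgt e : ept e (len e) = vpt (tgt e).
Proof.
rewrite /ept; case: insubP => [? /=|_]; first by rewrite ltxx andbF.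
by rewrite leNgt len_gt0.
Qed.

Lemma ept_interior e (t : R) (ht : 0 < t < len e) :
  ept e t = inr (exist (fun x : edge G * R => 0 < x.2 < len x.1) (e, t) ht).
Proof.
rewrite /ept; case: insubP => [w _ we|/=]; last by rewrite ht.
by congr inr; apply: val_inj.
Qed.

(** Presents interior points as [ept e t], the form used by slopes and edge formulas, instead of
    dependent pairs. *)
Lemma pt_ind (P : pt G -> Prop) :
  (forall v, P (vpt v)) -> (forall e t, 0 < t < len e -> P (ept e t)) ->
  forall p, P p.
Proof.
move=> Pv Pe [v|[[e t] /= ht]]; first exact: Pv.
by have := Pe e t ht; rewrite ept_interior.
Qed.

(** Gluing of edge profiles. Only interior values of [phi] are read, so agreement with [u] at the
    ends is a separate hypothesis below. *)
Definition edgewise (phi : edge G -> R -> R) u : pt G -> R := fun p =>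
  match p with inl v => u v | inr w => phi (val w).1 (val w).2 end.

Section Edgewise.
Variables (phi : edge G -> R -> R) (u : vertex G -> R).
Hypothesis phi_src : forall e, phi e 0 = u (src e).
Hypothesis phi_tgt : forall e, phi e (len e) = u (tgt e).

Lemma edgewise_ept e t : 0 <= t <= len e -> edgewise phi u (ept e t) = phi e t.
Proof.
rewrite le_eqVlt => /andP[/predU1P[<- _|t0]]; first by rewrite ept_src phi_src.
rewrite le_eqVlt => /predU1P[->|tl]; first by rewrite ept_tgt phi_tgt.
have ht : 0 < t < len e by rewrite t0.
by rewrite (ept_interior ht).
Qed.

Lemma edgewise_cpa :
  (forall e, continuous (phi e)) ->
  (forall e, piecewise_affine_on 0 (len e) (phi e)) -> cpa (edgewise phi u).
Proof.
move=> cphi aphi e; split.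
  apply: (@subspace_eq_continuous _ _ _ (phi e)); last exact: continuous_subspaceT.
  by move=> t; rewrite inE/= in_itv/= => /edgewise_ept.
have [S hS] := aphi e; exists S => c d c0 cd dl /(hS c d c0 cd dl)[m [k mk]].
by exists m, k => t tcd; rewrite edgewise_ept ?mk//; lra.
Qed.

End Edgewise.

Lemma lim_right_slope (F : R -> R) (t s m : R) :
  (\forall h \near 0^'+, F (t + s * h) = F t + m * h) ->
  lim ((F (t + s * h) - F t) / h @[h --> 0^'+]) = m.
Proof.
move=> Fm; apply: lim_near_cst => //; near=> h.
have -> : F (t + s * h) = F t + m * h by near: h.
have h0 : 0 < h by near: h; exact: nbhs_right_gt.
by rewrite addrC addKr mulfK// gt_eqF.
Unshelve. all: by end_near.
Qed.

Lemma slope_fwdE f e t m :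
  (\forall h \near 0^'+, f (ept e (t + h)) = f (ept e t) + m * h) ->
  slope_fwd f e t = m.
Proof.
move=> fm; rewrite -(@lim_right_slope (f \o ept e) t 1 m).
  by under [in RHS]eq_fun do rewrite mul1r.
by under eq_near do rewrite mul1r.
Qed.

Lemma slope_bwdE f e t m :
  (\forall h \near 0^'+, f (ept e (t - h)) = f (ept e t) + m * h) ->
  slope_bwd f e t = m.
Proof.
move=> fm; rewrite -(@lim_right_slope (f \o ept e) t (-1) m).
  by under [in RHS]eq_fun do rewrite mulN1r.
by under eq_near do rewrite mulN1r.
Qed.

(** The difference quotient is eventually constant, so the [lim] defining the slope is a genuine
    limit and not a default value. *)
Lemma cpa_slope_fwd f e t : cpa f -> 0 <= t < len e ->
  \forall h \near 0^'+, f (ept e (t + h)) = f (ept e t) + slope_fwd f e t * h.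
Proof.
move=> /(_ e)[cf af] tl.
have [||||m] := @piecewise_affine_germ _ _ _ _ t 1 (len e - t) cf af;
  [by left|lra|lra|lra|].
under eq_near do rewrite mul1r.
by move=> fm; rewrite (slope_fwdE fm).
Qed.

Lemma cpa_slope_bwd f e t : cpa f -> 0 < t <= len e ->
  \forall h \near 0^'+, f (ept e (t - h)) = f (ept e t) + slope_bwd f e t * h.
Proof.
move=> /(_ e)[cf af] tl.
have [||||m] := @piecewise_affine_germ _ _ _ _ t (-1) t cf af;
  [by right|lra|lra|lra|].
under eq_near do rewrite mulN1r.
by move=> fm; rewrite (slope_bwdE fm).
Qed.

Section LinearCombination.
Variables (f g : pt G -> R) (a : R).
Hypotheses (cf : cpa f) (cg : cpa g).
Let fg p := f p + a * g p.

Lemma cpaD_scale : cpa fg.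
Proof.
move=> e; have [kf [S hS]] := cf e; have [kg [S' hS']] := cg e; split.
  move=> t; apply: cvgD; first exact: kf.
  by apply: cvgMr; exact: kg.
exists (S ++ S') => c d c0 cd dl cdS.
have [s sS|m [k mk]] := hS c d c0 cd dl.
  by apply: cdS; rewrite mem_cat sS.
have [s sS|m' [k' mk']] := hS' c d c0 cd dl.
  by apply: cdS; rewrite mem_cat sS orbT.
exists (m + a * m'), (k + a * k') => t tcd.
rewrite /fg mk// mk'//; ring.
Qed.

Lemma slope_fwdD_scale e t : 0 <= t < len e ->
  slope_fwd fg e t = slope_fwd f e t + a * slope_fwd g e t.
Proof.
move=> tl; apply: slope_fwdE.
apply: filterS2 (cpa_slope_fwd cf tl) (cpa_slope_fwd cg tl) => h fh gh.
rewrite /fg fh gh; ring.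
Qed.

Lemma slope_bwdD_scale e t : 0 < t <= len e ->
  slope_bwd fg e t = slope_bwd f e t + a * slope_bwd g e t.
Proof.
move=> tl; apply: slope_bwdE.
apply: filterS2 (cpa_slope_bwd cf tl) (cpa_slope_bwd cg tl) => h fh gh.
rewrite /fg fh gh; ring.
Qed.

(** Linearity rests on [cpa]: the slopes add because both functions have affine germs in every
    direction. The form [f + a g] covers sums, differences and multiples. *)
Lemma laplacianD_scale p : laplacian fg p = laplacian f p + a * laplacian g p.
Proof.
rewrite mulrN -opprD /laplacian; congr (- _).
case: p => [v|[[e t] /= /andP[t0 tl]]]; last first.
  rewrite slope_fwdD_scale ?slope_bwdD_scale ?(ltW t0) ?(ltW tl) ?t0//.
  ring.
rewrite mulrDr !mulr_sumr addrACA -!big_split/=.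
congr (_ + _); apply: eq_bigr => e _.
  by rewrite slope_fwdD_scale// lexx len_gt0.
by rewrite slope_bwdD_scale// lexx len_gt0.
Qed.

End LinearCombination.

(** At an interior point a zero Laplacian makes the two outgoing slopes opposite, so the one-sided
    germs join into one affine germ and [locally_affine_affine] applies. *)
Lemma edge_affine f e : cpa f ->
  (forall t, 0 < t < len e -> laplacian f (ept e t) = 0) ->
  forall t, 0 <= t <= len e ->
    f (ept e t) = f (vpt (src e)) + (f (vpt (tgt e)) - f (vpt (src e))) / len e * t.
Proof.
move=> cf lf t tl; have [kf _] := cf e.
rewrite -ept_src -ept_tgt.
have := locally_affine_affine (len_gt0 e) kf _ tl; rewrite !subr0; apply => {}t {}tl.
exists (slope_fwd f e t).
have fb : slope_fwd f e t = - slope_bwd f e t.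
  have /eqP := lf t tl.
  by rewrite (ept_interior tl) /laplacian/= oppr_eq0 addr_eq0 => /eqP.
have tl' : 0 <= t < len e by lra.
have tl'' : 0 < t <= len e by lra.
have : \forall u \near t^'-,
    f (ept e u) = f (ept e t) + slope_fwd f e t * (u - t).
  apply/nbhs_left0P; apply: filterS (cpa_slope_bwd cf tl'') => h ->.
  rewrite fb; ring.
have : \forall u \near t^'+,
    f (ept e u) = f (ept e t) + slope_fwd f e t * (u - t).
  apply/nbhs_right0P; apply: filterS (cpa_slope_fwd cf tl') => h ->; ring.
rewrite !near_withinE => right left; near=> u.
have [->|] := eqVneq u t; first by rewrite subrr mulr0 addr0.
by rewrite neq_lt => /orP[]; near: u.
Unshelve. all: by end_near.
Qed.

(** Bridge to the finite graph: the outgoing slope of an affine edge is its increment divided by its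
    length. Since [laplacian] is [- sigma], the two Laplacians have opposite signs. *)
Lemma sigma_vertex f v :
  (forall e t, 0 <= t <= len e ->
    f (ept e t) = f (vpt (src e)) + (f (vpt (tgt e)) - f (vpt (src e))) / len e * t) ->
  sigma f (vpt v) = discrete_laplacian (f \o @vpt _ G) v.
Proof.
move=> fE; rewrite /discrete_laplacian/=.
congr (_ + _); apply: eq_bigr => e /eqP <-.
  apply: slope_fwdE; near=> h.
  have h1 : 0 < h by near: h; exact: nbhs_right_gt.
  have h2 : h < len e by near: h; exact/nbhs_right_lt/len_gt0.
  rewrite add0r !fE; [ring|lra..].
apply: slope_bwdE; near=> h.
have h1 : 0 < h by near: h; exact: nbhs_right_gt.
have h2 : h < len e by near: h; exact/nbhs_right_lt/len_gt0.
rewrite !fE; [|lra..].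
have : len e != 0 by rewrite gt_eqF ?len_gt0.
by move=> ?; field.
Unshelve. all: by end_near.
Qed.

End PiecewiseAffine.

(** * Uniqueness and existence of potentials, and the Green function of an edge *)

Section Resistance.
Context {R : realType}.
Variable G : metrized_graph R.
Implicit Types (f g : pt G -> R) (e : edge G) (v : vertex G) (p y z : pt G).

Lemma harmonic_constant f :
  cpa f -> (forall p, laplacian f p = 0) -> forall p y, f p = f y.
Proof.
move=> cf f0.
have fE e t : 0 <= t <= len e -> f (ept e t) =
    f (vpt (src e)) + (f (vpt (tgt e)) - f (vpt (src e))) / len e * t.
  by move=> tl; apply: edge_affine.
have fv v v' : f (vpt v) = f (vpt v').
  apply: (@discrete_harmonic_constant _ _ (f \o @vpt _ G)) => {}v.
  by rewrite -sigma_vertex// -[LHS]opprK -[X in - X]/(laplacian f (vpt v)) f0 oppr0.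
have [v0 _] : exists v0 : vertex G, v0 \in predT.
  by apply/existsP; rewrite -[X in is_true X]negbK -/(pred0b _) -lt0n vertex_neq0.
suff fp p : f p = f (vpt v0) by move=> p y; rewrite !fp.
move: p; apply: pt_ind => [v|e t tl]; first exact: fv.
rewrite fE; last lra.
by rewrite (fv (tgt e) (src e)) subrr !mul0r addr0.
Qed.

Lemma constant_harmonic (a : R) :
  cpa (fun _ : pt G => a) /\ forall p, laplacian (fun=> a) p = 0.
Proof.
have fwd e t : slope_fwd (fun _ : pt G => a) e t = 0.
  by apply: slope_fwdE; near=> h; rewrite mul0r addr0.
have bwd e t : slope_bwd (fun _ : pt G => a) e t = 0.
  by apply: slope_bwdE; near=> h; rewrite mul0r addr0.
split=> [e|p].
  split; first by move=> t; exact: cvg_cst.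
  by exists [::] => *; exists 0, a => *; rewrite mul0r add0r.
rewrite /laplacian; case: p => [v|w] /=; last by rewrite fwd bwd addr0 oppr0.
by rewrite !big1 ?addr0 ?oppr0.
Unshelve. all: by end_near.
Qed.

(** Subtracting [f z] turns [f] into a voltage, so the set from which [get] chooses is inhabited.
    The chosen voltage differs from [f] by a harmonic function, hence by a constant. *)
Lemma resistanceE f y z : cpa f ->
  (forall p, laplacian f p = delta y p - delta z p) ->
  resistance y z = f y - f z.
Proof.
move=> cf lf.
have [c1 l1] := constant_harmonic 1.
pose f0 p := f p + - f z * 1.
have f0P : is_voltage z y f0.
  split; [exact: cpaD_scale|by rewrite /f0 mulr1 subrr|move=> p].
  by rewrite laplacianD_scale// l1 mulr0 addr0.
rewrite /resistance /voltage.
have [cg gz lg] : is_voltage z y (get [set f' : pt G -> R | is_voltage z y f']).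
  by apply: (@getPex _ [set f' : pt G -> R | is_voltage z y f']); exists f0.
set g := get _ in cg gz lg *.
have gf0 p : laplacian (fun p => g p + -1 * f p) p = 0.
  by rewrite laplacianD_scale// lg lf mulN1r subrr.
have := harmonic_constant (cpaD_scale (-1) cg cf) gf0 y z; rewrite gz; lra.
Qed.

Lemma sum_delta v : \sum_v' delta (vpt v) (vpt v' : pt G) = 1 :> R.
Proof.
rewrite (bigD1 v)//= /delta eqxx big1 ?addr0// => v' v'v.
by rewrite [_ == _](negPf v'v).
Qed.

(** A solution of the discrete Poisson equation is interpolated affinely along each edge. *)
Lemma vertex_potential v v' : exists2 f : pt G -> R, cpa f &
  forall p, laplacian f p = delta (vpt v) p - delta (vpt v') p.
Proof.
have [|u uE] := @discrete_poisson R G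
    (* The deltas are exchanged because [discrete_laplacian] corresponds to [sigma], the negative of
       [laplacian]. *)
    (fun w => delta (vpt v') (vpt w) - delta (vpt v) (vpt w)).
  by rewrite sumrB !sum_delta subrr.
pose phi e t := u (src e) + (u (tgt e) - u (src e)) / len e * t.
have phi0 e : phi e 0 = u (src e) by rewrite /phi mulr0 addr0.
have phi1 e : phi e (len e) = u (tgt e).
  by rewrite /phi divfK ?gt_eqF ?len_gt0// addrC subrK.
have cf : cpa (edgewise phi u).
  apply: edgewise_cpa => // e.
    move=> t; apply: cvgD; first exact: cvg_cst.
    by apply: cvgMr; exact: cvg_id.
  by exists [::] => *; do 2 eexists => *; rewrite /phi addrC.
exists (edgewise phi u) => //; apply: pt_ind => [w|e t tl].
  rewrite /laplacian sigma_vertex => [|e t tl]; last by rewrite edgewise_ept.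
  by rewrite [discrete_laplacian _ w]uE opprB.
rewrite (ept_interior tl) /laplacian/=.
have [m mE] : exists m, forall h, phi e (t + h) = phi e t + m * h.
  by eexists => h; rewrite /phi mulrDr addrA.
rewrite (@slope_fwdE _ _ _ e t m); last first.
  near=> h; have h1 : 0 < h by near: h; exact: nbhs_right_gt.
  have h2 : h < len e - t by near: h; apply: nbhs_right_lt; lra.
  by rewrite !edgewise_ept ?mE//; lra.
rewrite (@slope_bwdE _ _ _ e t (- m)); last first.
  near=> h; have h1 : 0 < h by near: h; exact: nbhs_right_gt.
  have h2 : h < t by near: h; apply: nbhs_right_lt; lra.
  by rewrite !edgewise_ept ?mE//; lra.
by rewrite /delta/= !subrr oppr0.
Unshelve. all: by end_near.
Qed.

Section EdgeGreen.
Variables (e0 : edge G) (c : R).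
Hypothesis c_itv : 0 < c < len e0.

Definition segment_green e t :=
  if e == e0 then Num.min t c - t * (c / len e0) else 0.

Definition edge_green : pt G -> R := edgewise segment_green (fun=> 0).

Lemma segment_green_src e : segment_green e 0 = 0.
Proof.
have [c0 cl] := andP c_itv.
rewrite /segment_green; case: eqP => // _; rewrite mul0r subr0 min_l//; lra.
Qed.

Lemma segment_green_tgt e : segment_green e (len e) = 0.
Proof.
have [c0 cl] := andP c_itv.
rewrite /segment_green; case: eqP => // ->; rewrite min_r; last lra.
by rewrite mulrCA mulfV ?gt_eqF ?len_gt0// mulr1 subrr.
Qed.

Lemma edge_greenE e t : 0 <= t <= len e -> edge_green (ept e t) = segment_green e t.
Proof. apply: edgewise_ept; [exact: segment_green_src|exact: segment_green_tgt]. Qed.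

Lemma edge_green_cpa : cpa edge_green.
Proof.
have [c0 cl] := andP c_itv.
apply: edgewise_cpa => [||e|e]; [exact: segment_green_src|exact: segment_green_tgt|..];
  rewrite /segment_green; case: eqP => // _.
- move=> t; apply: cvgB; last by apply: cvgMl; exact: cvg_id.
  by apply: continuous_min; [exact: cvg_id|exact: cvg_cst].
- by move=> t; exact: cvg_cst.
- exists [:: c] => a b a0 ab bl /(_ c); rewrite inE eqxx => /(_ isT) cab.
  have [bc|cb] := leP b c.
    exists (1 - c / len e0), 0 => t tab; rewrite !min_l; [ring|lra..].
  exists (- (c / len e0)), c => t tab; rewrite min_r; [ring|].
  by move: cab; rewrite cb andbT -leNgt => ?; lra.
- by exists [::] => *; exists 0, 0 => *; rewrite mul0r add0r.
Qed.

Lemma edge_green_slope_fwd e t : 0 <= t < len e ->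
  slope_fwd edge_green e t = if e == e0 then (t < c)%R%:R - c / len e0 else 0.
Proof.
move=> tl; apply: slope_fwdE.
have [tc|ct] := ltP t c; near=> h;
  (have h1 : 0 < h by near: h; exact: nbhs_right_gt);
  (have h2 : h < len e - t by near: h; apply: nbhs_right_lt; lra);
  (rewrite !edge_greenE; [|lra..]); rewrite /segment_green;
  (case: ifP => _; last by rewrite mul0r addr0).
- have h3 : h < c - t by near: h; apply: nbhs_right_lt; lra.
  by rewrite /= !min_l; [ring|lra..].
- by rewrite /= !min_r; [ring|lra..].
Unshelve. all: by end_near.
Qed.

(** The test is [t <= c] here and [t < c] forwards: at [t = c] on [e0] the slopes add up to [-1],
    which is the unit mass of the Laplacian at [c]. *)
Lemma edge_green_slope_bwd e t : 0 < t <= len e ->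
  slope_bwd edge_green e t = if e == e0 then c / len e0 - (t <= c)%R%:R else 0.
Proof.
move=> tl; apply: slope_bwdE.
have [tc|ct] := leP t c; near=> h;
  (have h1 : 0 < h by near: h; exact: nbhs_right_gt);
  (have h2 : h < t by near: h; apply: nbhs_right_lt; lra);
  (rewrite !edge_greenE; [|lra..]); rewrite /segment_green;
  (case: ifP => _; last by rewrite mul0r addr0).
- by rewrite /= !min_l; [ring|lra..].
- have h3 : h < t - c by near: h; apply: nbhs_right_lt; lra.
  by rewrite /= !min_r; [ring|lra..].
Unshelve. all: by end_near.
Qed.

Lemma edge_green_laplacian p : laplacian edge_green p = delta (ept e0 c) p
  - (1 - c / len e0) * delta (vpt (src e0)) p
  - c / len e0 * delta (vpt (tgt e0)) p.
Proof.
have [c0 cl] := andP c_itv.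
rewrite (ept_interior c_itv) /laplacian.
move: p; apply: pt_ind => [v|e t tl]; last first.
  rewrite (ept_interior tl)/= edge_green_slope_fwd; last lra.
  rewrite edge_green_slope_bwd; last lra.
  rewrite /delta !mulr0 !subr0.
  have -> : (inr (exist _ (e, t) tl) == inr (exist _ (e0, c) c_itv) :> pt G)
      = (e == e0) && (t == c) by [].
  case: ifP => _; last by rewrite addr0 oppr0.
  rewrite /=; case: ltgtP => _ /=; ring.
(* Only [e0] contributes. Sources and targets are summed separately, so a self-loop needs no special
   case. *)
have pick (h : edge G -> vertex G) x :
    \sum_(e | h e == v) (if e == e0 then x else 0) = (v == h e0)%:R * x :> R.
  rewrite big_mkcond (bigD1 e0)//= eqxx big1 => [|e /negPf->]; last by rewrite if_same.
  by rewrite addr0 eq_sym; case: eqP; rewrite ?mul1r ?mul0r.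
rewrite /=; under eq_bigr do rewrite edge_green_slope_fwd ?lexx ?len_gt0//.
under [X in _ + X]eq_bigr do rewrite edge_green_slope_bwd ?lexx ?len_gt0//.
rewrite c0.
transitivity (- (\sum_(e | src e == v) (if e == e0 then 1 - c / len e0 else 0) +
  \sum_(e | tgt e == v) (if e == e0 then c / len e0 else 0))).
  congr (- (_ + _)); apply: eq_bigr => e _; case: eqP => // ->.
  by rewrite leNgt cl subr0.
rewrite !pick /delta.
have vE (w : vertex G) : (vpt v == vpt w) = (v == w) by [].
rewrite !vE [_ == inr _](_ : _ = false)//=; ring.
Qed.

End EdgeGreen.

(** Includes [c = 0] and [c = len e]: there the point is a vertex, the three masses cancel and the
    zero function serves. *)
Lemma edge_potential (e : edge G) (c : R) : 0 <= c <= len e ->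
  exists k : pt G -> R, [/\ cpa k,
    forall p, laplacian k p = delta (ept e c) p
      - (1 - c / len e) * delta (vpt (src e)) p
      - c / len e * delta (vpt (tgt e)) p &
    forall t, 0 <= t <= len e -> k (ept e t) = Num.min t c - t * (c / len e)].
Proof.
have l0 : len e != 0 by rewrite gt_eqF ?len_gt0.
have [cz lz] := constant_harmonic 0.
rewrite le_eqVlt => /andP[/predU1P[<- _|c0]].
  exists (fun=> 0); split=> // [p|t /andP[t0 _]].
    by rewrite lz ept_src; ring.
  by rewrite min_r// mul0r mulr0 subrr.
rewrite le_eqVlt => /predU1P[->|cl].
  exists (fun=> 0); split=> // [p|t /andP[_ tl]].
    by rewrite lz ept_tgt divff//; ring.
  by rewrite min_l// divff// mulr1 subrr.
have c_itv : 0 < c < len e by rewrite c0.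
exists (edge_green e c); split=> [|p|t tl].
- exact: edge_green_cpa.
- exact: edge_green_laplacian.
- by rewrite edge_greenE// /segment_green eqxx.
Qed.

End Resistance.

Theorem lemma3p1 (R : realType) (G : metrized_graph R) (e : edge G) (x y : R)
    (hx : 0 <= x <= len e) (hy : 0 <= y <= len e) :
  resistance (ept e x) (ept e y) =
  `|x - y| - (x - y) ^+ 2 *
    ((len e - resistance (vpt (src e)) (vpt (tgt e))) / len e ^+ 2).
Proof.
have l0 : len e != 0 by rewrite gt_eqF ?len_gt0.
have [kx [ckx lkx kxE]] := edge_potential hx.
have [ky [cky lky kyE]] := edge_potential hy.
have [g cg lg] := vertex_potential (src e) (tgt e).
have gE t : 0 <= t <= len e -> g (ept e t) =
    g (vpt (src e)) + (g (vpt (tgt e)) - g (vpt (src e))) / len e * t.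
  apply: edge_affine => // {}t tl.
  by rewrite lg (ept_interior tl) /delta/= subrr.
have ckxy := cpaD_scale (-1) ckx cky.
rewrite (resistanceE cg lg).
(* With [L = len e], [kx - ky] leaves mass [(x - y) / L] at the source and its opposite at the
   target; the multiple of [g] cancels both. *)
rewrite (resistanceE (cpaD_scale ((y - x) / len e) ckxy cg)); last first.
  move=> p; rewrite !laplacianD_scale// lkx lky lg.
  by field.
(* The Green terms give [x + y - 2 min(x, y) - (x - y)^2 / L], where
   [x + y - 2 min(x, y) = |x - y|]; the [g] term adds [(x - y)^2 r(p, q) / L^2]. *)
rewrite !kxE// !kyE// !gE// !minxx (minC y x).
have [xy|yx] := leP x y.
- by rewrite ler0_norm ?subr_le0//; field.
- by rewrite gtr0_norm ?subr_gt0//; field.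
Qed.
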